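(* Assume that there exist functions $m_1,m_2:S\to[2,+\infty)$ and $\varphi_1,\varphi_2,\psi_1,\psi_2:S\to(0,+\infty)$ such that $$\psi_1(x)+\varphi_1(x)t^{m_1(x)-1}\le f(x,t)\le \varphi_2(x)t^{m_2(x)-1}+\psi_2(x)\quad\text{for all }x\in S,\ t\ge 0,$$ and let $m_1^->\overline p^+$. Put $$\lambda_2:=\frac{\frac{q^-}{p^+}\,2^{-\frac{p^+}{2}}|\partial S|^{\frac{p^+}{2}}|\overline S|^{1-p^+}|\overline S|^{-\frac{p^+}{2}}}{\left(\frac{\varphi_2^+}{m_2^-}|\overline S|^{-\frac{m_2^-}{2}}+\psi_2^+\right)|S|}.$$ Then for every $\lambda\in(0,\lambda_2)$ the problem $$\begin{cases}-\Delta_{p(x),\omega}u(x)+q(x)|u(x)|^{p(x)-2}u(x)=\lambda f(x,u(x)), & x\in S,\\ u(x)=0, & x\in\partial S,\end{cases}$$ has at least two distinct positive solutions.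
   Context: Let $\overline S=(S\cup\partial S,V)$ be a simple, connected, undirected, weighted graph whose vertex set is the union of two finite, disjoint, nonempty sets $S$ (interior) and $\partial S$ (boundary), and whose edge set is $V$, a set of unordered pairs of distinct vertices. The symbol $\overline S$ also denotes the vertex set $S\cup\partial S$; $|\cdot|$ of a set is its cardinality. The weight is a function $\omega:\overline S\times\overline S\to[0,+\infty)$ with $\omega(x,y)=\omega(y,x)$ if $\{x,y\}\in V$, and $\omega(x,y)=0$ if and only if $\{x,y\}\notin V$. The functions $q:S\to(0,+\infty)$ and $p:\overline S\to[2,+\infty)$ are given, and $f:S\times\mathbb R\to\mathbb R$ is such that $f(x,\cdot)$ is continuous for each $x\in S$. The discrete $p(\cdot)$-Laplacian of $u:\overline S\to\mathbb R$ is $$\Delta_{p(x),\omega}u(x)=\sum_{y\in\overline S}|u(y)-u(x)|^{p(x)-2}(u(y)-u(x))\,\omega(x,y),\quad x\in\overline S.$$ A positive solution is a function $u:\overline S\to\mathbb R$ satisfying the equation on $S$, the boundary condition $u=0$ on $\partial S$, and $u(x)>0$ for all $x\in S$. Notation: $p^+=\max_{S}p$, $\overline p^+=\max_{\overline S}p$, $q^-=\min_S q$, $m_1^-=\min_S m_1$, $m_2^-=\min_S m_2$, $\varphi_2^+=\max_S\varphi_2$, $\psi_2^+=\max_S\psi_2$. *)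

(* Defs.v *)
From HB Require Import structures.
From mathcomp Require Import all_boot all_order all_algebra.
From mathcomp Require Import all_classical all_reals all_analysis.
Import Order.TTheory GRing.Theory Num.Theory.
Import numFieldNormedType.Exports.

Set Implicit Arguments.
Unset Strict Implicit.
Unset Printing Implicit Defensive.

Local Open Scope ring_scope.

(* The finite type [T] is the whole vertex set,
   [S : {set T}] the interior and [~: S] the boundary.  A function whose
   natural domain is [S] is a function on [T] used only at points of [S]. *)

Section Graph.
Variable T : finType.

Definition simple_graph (e : rel T) : Prop := symmetric e /\ irreflexive e.

Definition connected_graph (e : rel T) : Prop := forall x y, connect e x y.

Section Weight.
Variable R : realType.

Definition graph_weight (e : rel T) (w : T -> T -> R) : Prop :=
  [/\ forall x y, 0 <= w x y,
      forall x y, e x y -> w x y = w y x &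
      forall x y, w x y = 0 <-> ~~ e x y].

(* Seeded with a value of [g] on [A], so that no artificial 0 enters the
   extremum; the value 0 on the empty set is a dummy. *)
Definition max_on (A : {set T}) (g : T -> R) : R :=
  if [pick x in A] is Some x0 then \big[Num.max/g x0]_(x in A) g x else 0.

Definition min_on (A : {set T}) (g : T -> R) : R :=
  if [pick x in A] is Some x0 then \big[Num.min/g x0]_(x in A) g x else 0.

(* [powR] satisfies [0 `^ 0 = 1] and [0 `^ a = 0] for [a != 0]; as the power
   is multiplied by [u y - u x], the terms with [u y = u x] vanish even when
   [p x = 2]. *)
Definition plaplacian (w : T -> T -> R) (p u : T -> R) (x : T) : R :=
  \sum_(y : T) `|u y - u x| `^ (p x - 2) * (u y - u x) * w x y.

Definition positive_solution (S : {set T}) (w : T -> T -> R) (p q : T -> R)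
    (f : T -> R -> R) (lambda : R) (u : T -> R) : Prop :=
  [/\ forall x, x \in S ->
        - plaplacian w p u x + q x * `|u x| `^ (p x - 2) * u x
          = lambda * f x (u x),
      forall x, x \in ~: S -> u x = 0 &
      forall x, x \in S -> 0 < u x].

Definition lambda2 (S : {set T}) (p q m2 phi2 psi2 : T -> R) : R :=
  let pp := max_on S p in
  let qm := min_on S q in
  let m2m := min_on S m2 in
  let phi2p := max_on S phi2 in
  let psi2p := max_on S psi2 in
  let cS : R := #|S|%:R in
  let cB : R := #|~: S|%:R in
  let cT : R := #|T|%:R in
  (qm / pp * 2 `^ (- (pp / 2)) * cB `^ (pp / 2) * cT `^ (1 - pp)
     * cT `^ (- (pp / 2)))
  / ((phi2p / m2m * cT `^ (- (m2m / 2)) + psi2p) * cS).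

End Weight.
End Graph.

(* Main.v *)
Require Import Defs.
From HB Require Import structures.
From mathcomp Require Import all_boot all_order all_algebra.
From mathcomp Require Import all_classical all_reals all_analysis.
From mathcomp Require Import ring lra.
Import Order.TTheory GRing.Theory Num.Theory.
Import numFieldNormedType.Exports.

Set Implicit Arguments.
Unset Strict Implicit.
Unset Printing Implicit Defensive.

Local Open Scope ring_scope.
(* Since [p] depends on the vertex, the [p(x)]-Laplacian is not a gradient, so the
   proof is topological.  Let [G u x] be the difference of the two sides of the
   equation.  The bound on [lambda] gives an interval [c, c'] of constant strict
   supersolutions, while [m1 > p] makes [G u x] negative as soon as [u x] is large,
   whatever the other values of [u >= 0] are; and [G u x < 0] where [u x = 0].
   A variational inequality on the box [0, c]^T then has a solution in the
   interior, which is the first solution.  For the second one, the unknowns are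
   [u] and the level [r] of its maximum, and a multiple of [max u - r] is added to
   [G]; the signs of [G] at the points where [u] is maximal force [max u = r] and
   [G u = 0], with [r >= c].  The variational inequality, equivalent to Brouwer's
   theorem, is deduced from Kuhn's combinatorial lemma, itself proved by Stokes'
   formula modulo 2 for the cup product of the coboundaries of the labels. *)

(** * A variational inequality on boxes *)

Section Kuhn.
Variables (I : finType) (m : nat).
Local Notation pt := {ffun I -> 'I_m.+2}.
Implicit Types (D : {set I}) (v : pt).

(* Addition of points is cyclic; the steps that wrap around are excluded by [slab]. *)
Definition unit_pt (i : I) : pt := [ffun j => (j == i)%:R].

(* [cup [:: g1; ...; gn] D v] is the cup product of the coboundaries of the [gi] on
   the cube of directions [D] at [v]: a sum over the monotone paths from [v]. *)
Fixpoint cup (gs : seq (pt -> 'F_2)) D v : 'F_2 :=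
  if gs is g :: gs' then
    \sum_(i in D) (g (v + unit_pt i) - g v) * cup gs' (D :\ i) (v + unit_pt i)
  else 1.

Lemma addF2K (x : 'F_2) : x + x = 0.
Proof. by rewrite -mulr2n -mulr_natr pchar_Zp // mulr0. Qed.

(** The terms at [(i, j)] and [(j, i)] are equal and cancel in characteristic two; [lt] picks one
    from each pair. *)
Lemma sum_offdiag_sym D (A : I -> I -> 'F_2) :
  (forall i j, A i j = A j i) -> \sum_(i in D) \sum_(j in D :\ i) A i j = 0.
Proof.
move=> symA; rewrite pair_big_dep /=.
pose lt (u : I * I) := (enum_rank u.1 < enum_rank u.2)%N.
pose sw (u : I * I) := (u.2, u.1).
rewrite (bigID lt) /=.
rewrite [X in _ + X](reindex_inj (h := sw)) /=; last first.
  by move=> [a b] [c d] /= [-> ->].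
apply: etrans (addF2K (\sum_(u | [&& u.1 \in D, u.2 \in D & lt u]) A u.1 u.2)).
congr (_ + _); apply: eq_big => -[i j] /=; rewrite ?finset.in_setD1 /lt /= //.
- by case: eqVneq => [->|]; rewrite ?ltnn ?andbF // -andbA.
- rewrite -leqNgt leq_eqVlt; case: eqVneq => [->|ij] /=.
    by rewrite ltnn !andbF.
  have -> : (enum_rank i == enum_rank j :> nat) = false.
    by apply/negbTE; apply: contra ij => /eqP /val_inj /enum_rank_inj ->.
  by rewrite andbA [(j \in D) && _]andbC -andbA.
Qed.

(* The coboundary of [cup gs] on the cube of directions [D] is zero. *)
Lemma cup_closed gs D v :
  \sum_(i in D) (cup gs (D :\ i) (v + unit_pt i) - cup gs (D :\ i) v) = 0.
Proof.
elim: gs D v => [|g gs IH] D v /=; first by rewrite big1 // => i; rewrite subrr.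
pose C i j := cup gs (D :\ i :\ j).
have symC i j x : C i j x = C j i x by rewrite /C !finset.setDDl finset.setUC.
have e i j : v + unit_pt i + unit_pt j = v + unit_pt j + unit_pt i.
  by rewrite addrAC.
(* The terms are regrouped so that [A1] is symmetric in [i] and [j], while the sums of [A2] and [A3]
   over [j] vanish by the induction hypothesis on [D :\ i], at [v + unit_pt i] and at [v]. *)
pose A1 i j := g (v + unit_pt i + unit_pt j) * C i j (v + unit_pt i + unit_pt j)
  - (g (v + unit_pt i) * C i j (v + unit_pt i)
     + g (v + unit_pt j) * C i j (v + unit_pt j)) + g v * C i j v.
pose A2 i j := C i j (v + unit_pt i + unit_pt j) - C i j (v + unit_pt i).
pose A3 i j := C i j (v + unit_pt j) - C i j v.
transitivity (\sum_(i in D) \sum_(j in D :\ i) A1 i j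
   - \sum_(i in D) g (v + unit_pt i) * \sum_(j in D :\ i) A2 i j
   + \sum_(i in D) g v * \sum_(j in D :\ i) A3 i j).
  rewrite -sumrB -big_split; apply: eq_bigr => i _ /=.
  rewrite !mulr_sumr -!sumrB -big_split; apply: eq_bigr => j _ /=.
  by rewrite /A1 /A2 /A3 /C; ring.
rewrite sum_offdiag_sym; last first.
  by move=> i j; rewrite /A1 e !(symC i j) [X in _ - X]addrC.
by rewrite !big1 ?subrr ?addr0 // => i _; rewrite /A2 /A3 IH mulr0.
Qed.

(** The monotone paths stay in the face through [v] with directions [D], so the increment of [g k]
    is a zero factor on each of them. *)
Lemma cup_cst (g : I -> pt -> 'F_2) s k D v : k \in s ->
  (forall x y : pt, (forall i, i \notin D -> x i = v i) ->
     (forall i, i \notin D -> y i = v i) -> g k x = g k y) ->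
  cup (map g s) D v = 0.
Proof.
have unitD i j (E : {set I}) x : i \in E -> j \notin E -> (x + unit_pt i) j = x j.
  move=> iE jE; rewrite !ffunE; case: eqP => [ji|_]; last by rewrite addr0.
  by rewrite ji iE in jE.
elim: s D v => [//|h s IH] D v /=; rewrite inE => /predU1P[<-{h IH} gc|ks gc].
  rewrite big1 // => i iD; rewrite (gc (v + unit_pt i) v) ?subrr ?mul0r // => j jD.
  exact: unitD jD.
rewrite big1 // => i iD; rewrite IH ?mulr0 // => x y xv yv.
by apply: gc => j jD; rewrite ?xv ?yv ?finset.in_setD1 ?(negbTE jD) ?andbF //;
  apply: unitD jD.
Qed.

(** Some monotone path has only nonzero factors, so each label changes along one of its edges; [A]
    and [B] collect the directions travelled up to the two ends of that edge. *)
Lemma cup_neq0 (g : I -> pt -> 'F_2) s D v : cup (map g s) D v != 0 ->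
  forall k, k \in s -> exists A B : {set I}, [/\ A \subset D, B \subset D &
    g k (v + \sum_(i in A) unit_pt i) != g k (v + \sum_(i in B) unit_pt i)].
Proof.
elim: s D v => [//|h s IH] D v /= nz k.
have /existsP[i] : [exists i in D,
    (g h (v + unit_pt i) - g h v) * cup (map g s) (D :\ i) (v + unit_pt i) != 0].
  apply: contraNT nz; rewrite negb_exists_in => /forall_inP z.
  by rewrite big1 // => i /z /negPn /eqP.
rewrite mulf_eq0 negb_or subr_eq0 => /and3P[iD hi ci].
rewrite inE => /predU1P[->|ks].
  exists [set i], finset.set0; rewrite finset.sub1set iD finset.sub0set big_set1 big_set0 addr0.
  by split.
have [A [B [AD BD gAB]]] := IH _ _ ci k ks.
have U (X : {set I}) : X \subset D :\ i -> i |: X \subset D /\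
    v + \sum_(j in i |: X) unit_pt j = v + unit_pt i + \sum_(j in X) unit_pt j.
  rewrite finset.subsetD1 => /andP[XD iX]; split; first by rewrite finset.subUset finset.sub1set iD.
  by rewrite big_setU1 //= addrA.
have [AD' eA] := U A AD; have [BD' eB] := U B BD.
by exists (i |: A), (i |: B); rewrite eA eB.
Qed.

Lemma sum_unit_ptE (A : {set I}) i : (\sum_(j in A) unit_pt j) i = (i \in A)%:R.
Proof.
rewrite sum_ffunE; case: (boolP (i \in A)) => iA.
  rewrite (bigD1 i) //= ffunE eqxx big1 ?addr0 // => j /andP[_ ji].
  by rewrite ffunE eq_sym (negbTE ji).
rewrite big1 // => j jA; rewrite ffunE; case: eqP => // ij.
by rewrite ij jA in iA.
Qed.

Lemma ord_max_addr1 (a : 'I_m.+2) : (a + 1 == 0) = (a == ord_max).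
Proof.
have e : (ord_max : 'I_m.+2) + 1 = 0.
  apply: val_inj; rewrite /=. by rewrite addn1 modnn.
by apply/eqP/eqP => [h|->//]; apply: (addIr 1); rewrite h e.
Qed.

(* The points of a face of the box: free coordinates (indexed by [s]) avoid the
   last value, the other ones are equal to it. *)
Definition slab (s : seq I) v := [forall i, (v i == ord_max) (+) (i \in s)].

Let slab_off j (s : seq I) v :=
  [forall i, (i != j) ==> ((v i == ord_max) (+) (i \in s))].

Lemma slab_offE j s v : slab s v = slab_off j s v && ((v j == ord_max) (+) (j \in s)).
Proof.
apply/forallP/andP => [h|[/forallP h hj] i].
  by split; [apply/forallP => i; rewrite h implybT | exact: h].
by have := h i; case: eqVneq => [->|].
Qed.

(** The shift by [unit_pt j] turns the condition [v j != ord_max] into [v j != 0]; the common points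
    cancel and the two end faces in direction [j] remain. *)
Lemma slab_telescope (H : pt -> 'F_2) (s : seq I) j : j \in s ->
  \sum_(v | slab s v) (H (v + unit_pt j) - H v) =
  \sum_(v | slab_off j s v && (v j == ord_max)) H v
  - \sum_(v | slab_off j s v && (v j == 0)) H v.
Proof.
move=> js; rewrite sumrB.
have -> : \sum_(v | slab s v) H (v + unit_pt j) =
    \sum_(v | slab_off j s v && (v j != 0)) H v.
  rewrite [RHS](reindex_inj (h := fun v => v + unit_pt j)) /=; last exact: addIr.
  apply: eq_bigl => v; rewrite (slab_offE j) js addbT; congr (_ && _).
    apply: eq_forallb => i; case: eqVneq => //= ij.
    by rewrite !ffunE (negbTE ij) addr0.
  by rewrite !ffunE eqxx ord_max_addr1.
rewrite [\sum_(v | slab s v) _](eq_bigl (fun v => slab_off j s v && (v j != ord_max))).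
  have := bigID (fun v : pt => v j == 0) (slab_off j s) H (idx := 0) (op := +%R)
    (r := index_enum _).
  rewrite (bigID (fun v : pt => v j == ord_max)) /= => h.
  apply/eqP; rewrite subr_eq addrAC eq_sym subr_eq h addrC; exact/eqP.
by move=> v; rewrite (slab_offE j) js addbT.
Qed.

(** Induction on [s] by Stokes' formula: the cup product is a coboundary, so its sum reduces to end
    faces. Only the face where the coordinate of the first label is [ord_max] contributes, and it
    gives the sum for the shorter sequence. *)
Lemma cup_sum (g : I -> pt -> 'F_2) (s : seq I) :
  (forall i v, v i = 0 -> g i v = 0) ->
  (forall i v, v i = ord_max -> g i v = 1) -> uniq s ->
  \sum_(v | slab s v) cup (map g s) [set:: s] v = 1.
Proof.
move=> g0 g1; elim: s => [|i s IH] /=.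
  move=> _; rewrite (big_pred1 [ffun=> ord_max]) // => v.
  apply/forallP/eqP => [h|-> j]; last by rewrite ffunE eqxx.
  by apply/ffunP => j; rewrite ffunE; have := h j; rewrite addbF => /eqP.
case/andP=> is_ us.
pose D := [set:: i :: s]; pose C j := cup (map g s) (D :\ j).
(* Leibniz' rule: adding [g i v] times the relation [cup_closed] makes each summand the increment of
   the product of [g i] and [C j] in direction [j]. *)
transitivity (\sum_(j in D) \sum_(v | slab (i :: s) v)
    (g i (v + unit_pt j) * C j (v + unit_pt j) - g i v * C j v)).
  rewrite [RHS]exchange_big; apply: eq_bigr => v _ /=.
  have := congr1 ( *%R (g i v)) (cup_closed (map g s) D v).
  rewrite mulr0 mulr_sumr => cl; rewrite -[LHS]addr0 -[X in _ + X]cl -big_split.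
  by apply: eq_bigr => j _; rewrite /C /=; ring.
have iD : i \in D by rewrite inE mem_head.
rewrite (bigD1 i) //= [X in _ + X]big1 ?addr0 => [|j /andP[jD ji]].
  rewrite (slab_telescope (fun v => g i v * C i v)) ?mem_head //.
  rewrite [X in _ - X]big1 ?subr0 => [|v /andP[_ /eqP /g0->]]; last by rewrite mul0r.
  rewrite -[RHS](IH us); apply: eq_big => v; last first.
    case/andP=> _ /eqP /g1->; rewrite mul1r /C; congr cup.
    by apply/setP => j; rewrite !inE; case: eqVneq => // ->; rewrite (negbTE is_).
  rewrite [RHS](slab_offE i) (negbTE is_) addbF; congr andb.
  by apply: eq_forallb => j; rewrite inE; case: eqVneq.
have js : j \in s by move: jD; rewrite !inE (negbTE ji).
rewrite (slab_telescope (fun v => g i v * C j v)) ?inE ?js ?orbT //.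
(* For [j] in [s] the label [g j] is constant on both end faces in direction [j], so [C j] vanishes
   there. *)
have z v a : v j = a -> (forall x : pt, x j = a -> g j x = g j v) -> C j v = 0.
  move=> vj h; apply: (cup_cst js) => x y xv yv.
  have jn : j \notin D :\ j by rewrite !inE eqxx.
  by rewrite !h ?xv ?yv.
rewrite !big1 ?subr0 // => v /andP[_ /eqP vj]; rewrite (z _ _ vj) ?mulr0 // => x xj.
  by rewrite !g0.
by rewrite !g1.
Qed.

(* Kuhn's cubical form of Sperner's lemma. *)
Lemma kuhn_cell (g : I -> pt -> bool) :
  (forall i v, v i = 0 -> ~~ g i v) -> (forall i v, v i = ord_max -> g i v) ->
  exists v : pt, (forall i, v i < m.+1)%N /\
    forall k, exists x y : pt, [/\ ~~ g k x, g k y,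
      forall i, (v i <= x i <= v i + 1)%N & forall i, (v i <= y i <= v i + 1)%N].
Proof.
move=> g0 g1; pose h i v : 'F_2 := (g i v)%:R.
have us := enum_uniq I.
have hs : \sum_(v | slab (enum I) v) cup (map h (enum I)) [set:: enum I] v = 1.
  apply: cup_sum us => i v e; last by rewrite /h g1.
  by rewrite /h (negbTE (g0 _ _ e)).
have [v /andP[sv cv]|z] := pickP (fun v => slab (enum I) v &&
    (cup (map h (enum I)) [set:: enum I] v != 0)); last first.
  move: hs; rewrite big1 => [/esym/eqP|v sv]; first by rewrite oner_eq0.
  by have := z v; rewrite sv => /negbFE /eqP.
have vm i : (v i < m.+1)%N.
  have := forallP sv i; rewrite mem_enum addbT -(inj_eq val_inj) /= => vi.
  by rewrite ltn_neqAle vi -ltnS ltn_ord.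
exists v; split=> // k.
have cell (A : {set I}) i : (v i <= (v + \sum_(j in A) unit_pt j)%R i <= v i + 1)%N.
  rewrite ffunE sum_unit_ptE; case: (i \in A); last by rewrite addr0 leqnn leq_addr.
  have -> : val (v i + true%:R) = (v i + 1)%N by rewrite /= modn_small // addn1 ltnS.
  by rewrite leq_addr leqnn.
have [A [B [_ _]]] := cup_neq0 cv (mem_enum I k).
rewrite /h; case gA : (g k _); case gB : (g k _) => //=.
  move=> _; exists (v + \sum_(j in B) unit_pt j), (v + \sum_(j in A) unit_pt j).
  by rewrite gA gB.
move=> _; exists (v + \sum_(j in A) unit_pt j), (v + \sum_(j in B) unit_pt j).
by rewrite gA gB.
Qed.
End Kuhn.

(** * Passage to the limit in Kuhn's lemma *)

Section BoxInequality.
Variables (R : realType) (I : finType).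
Implicit Types (E : (I -> R) -> I -> R) (lo hi : I -> R).
Local Open Scope classical_set_scope.

Lemma ultra_fmap (X Y : Type) (h : X -> Y) (F : set_system X) :
  UltraFilter F -> UltraFilter (h x @[x --> F]).
Proof.
move=> UF; have PF : ProperFilter F := ultra_proper.
split=> [|G GP FG]; first exact: fmap_proper_filter.
apply/seteqP; split=> // A GA.
have [//|FnA] := in_ultra_setVsetC (h @^-1` A) UF.
have [z [Az]] := filter_ex (filterI GA (FG (~` A) FnA)); exact.
Qed.

(** Stated along arbitrary proper filters on indices, since the limit is taken along an
    ultrafilter. *)
Definition coord_continuous E := forall (F : set_system nat), ProperFilter F ->
  forall (u : nat -> I -> R) (l : I -> R), (forall i, u n i @[n --> F] --> l i) ->
  forall i, E (u n) i @[n --> F] --> E l i.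

(** Kuhn's lemma is applied to the grid of relative mesh [harmonic n], that is [1/(n+1)], with the
    sign of [E] as label. On the end faces the label is prescribed, hence the alternatives
    [x k k = lo k] and [y k k = hi k]. *)
Lemma box_kuhn_cell E lo hi (n : nat) : (forall i, lo i < hi i) ->
  exists (a : I -> R) (x y : I -> I -> R),
  [/\ forall i, lo i <= a i <= hi i,
      forall k i, `|x k i - a i| <= (hi i - lo i) * harmonic n
               /\ `|y k i - a i| <= (hi i - lo i) * harmonic n,
      forall k, x k k = lo k \/ E (x k) k <= 0
    & forall k, y k k = hi k \/ 0 <= E (y k) k].
Proof.
move=> lohi.
pose pos (v : {ffun I -> 'I_n.+2}) i := lo i + (hi i - lo i) * ((v i)%:R / n.+1%:R).
pose g k (v : {ffun I -> 'I_n.+2}) :=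
  (v k != 0) && ((v k == ord_max) || (0 < E (pos v) k)).
have [||v [vn /choice[x /choice[y xy]]]] := @kuhn_cell I n g.
- by move=> i v vi; rewrite /g vi eqxx.
- by move=> i v vi; rewrite /g vi eqxx.
have n0 : (0 : R) < n.+1%:R by rewrite ltr0n.
have dist (u : {ffun I -> 'I_n.+2}) i : (v i <= u i <= v i + 1)%N ->
    `|pos u i - pos v i| <= (hi i - lo i) * harmonic n.
  move=> /andP[h1 h2].
  have -> : pos u i - pos v i = (hi i - lo i) * (((u i)%:R - (v i)%:R) / n.+1%:R).
    by rewrite /pos; ring.
  have d0 : 0 <= hi i - lo i by rewrite subr_ge0 ltW.
  rewrite normrM (ger0_norm d0) ler_wpM2l // /harmonic /= normrM normfV (gtr0_norm n0).
  rewrite ler_piMl ?invr_ge0 ?(ltW n0) // -natrB // ger0_norm ?ler0n //.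
  by rewrite lern1 leq_subLR.
exists (pos v), (fun k => pos (x k)), (fun k => pos (y k)); split.
- move=> i; have d0 : 0 <= hi i - lo i by rewrite subr_ge0 ltW.
  have v1 : (v i)%:R / n.+1%:R <= 1 :> R.
    by rewrite ler_pdivrMr // mul1r ler_nat ltnW.
  have v0 : 0 <= (v i)%:R / n.+1%:R :> R by rewrite divr_ge0 ?ler0n.
  rewrite /pos lerDl mulr_ge0 //= -lerBrDl.
  by rewrite ler_piMr.
- by move=> k i; have [_ _ hx hy] := xy k; split; apply: dist.
- move=> k; have [gx _ _ _] := xy k; move: gx; rewrite /g negb_and negbK negb_or.
  case/orP => [/eqP e|/andP[_]]; last by rewrite -leNgt; right.
  by left; rewrite /pos e /= mul0r mulr0 addr0.
- move=> k; have [_ gy _ _] := xy k; move: gy; rewrite /g.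
  case/andP => _ /orP[/eqP e|/ltW]; last by right.
  by left; rewrite /pos e /= divff ?gt_eqF // mulr1 addrC subrK.
Qed.

(* Hartman-Stampacchia on a box *)
Lemma box_variational_inequality E lo hi : (forall i, lo i < hi i) ->
  coord_continuous E ->
  exists x : I -> R, [/\ forall i, lo i <= x i <= hi i,
    forall i, x i = lo i \/ E x i <= 0 & forall i, x i = hi i \/ 0 <= E x i].
Proof.
move=> lohi contE.
have /choice[a /choice[x /choice[y axy]]] := fun n => @box_kuhn_cell E lo hi n lohi.
(* Along an ultrafilter finer than [\oo] all coordinates of the corners [a n] converge at once, each
   side of the box being compact. *)
have [U [ultraU ooU]] := ultraFilterLemma (F := \oo%classic) _.
have PU : ProperFilter U by exact: ultra_proper.
have /choice[l lP] : forall i, exists l, lo i <= l <= hi i /\ a n i @[n --> U] --> l.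
  move=> i; have := @segment_compact R (lo i) (hi i); rewrite compact_ultra.
  have UU : UltraFilter (a n i @[n --> U]).
    exact: ultra_fmap.
  move=> /(_ _ UU) [|l [/= li al]].
    have : U ((fun n => a n i) @^-1` [set` `[lo i, hi i]%R]) by apply: filterE => n; have [h _ _ _] := axy n; rewrite /= in_itv; exact: h.
    exact.
  by exists l; split=> //; move: li; rewrite in_itv.
(* The mesh tends to 0, so all chosen vertices of the cells share the limit of the corners. *)
have near_a (z : nat -> I -> R) i : (forall n, `|z n i - a n i| <=
    (hi i - lo i) * harmonic n) -> z n i @[n --> U] --> l i.
  move=> za; rewrite -[l i](addr0) -[X in X @ _](_ : (fun n => a n i + (z n i - a n i)) = _); last first.
    by apply/funext => n; rewrite addrC subrK.
  apply: (@cvgD _ _ _ U _ (fun n => a n i)); first exact: (lP i).2.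
  apply: norm_cvg0; apply: (@squeeze_cvgr _ _ _ _ (fun=> 0) (fun n => (hi i - lo i) * harmonic n)).
  - by apply: nearW => n; rewrite normr_ge0 za.
  - exact: cvg_cst.
  - apply: (@cvg_trans _ ((fun n => (hi i - lo i) * harmonic n) @ \oo)).
      by apply: cvg_app; exact: ooU.
    have h0 := @cvgMl_tmp R nat \oo%classic _ _ (hi i - lo i) _ (@cvg_harmonic R).
    by rewrite mulr0 in h0; exact: h0.
exists l; split=> k; first exact: (lP k).1.
(* If [lo k < l k] and [0 < E l k], both inequalities hold at [x n k] for some [n], against the
   alternative that the cell provides. *)
- have [<-|xlo] := eqVneq (l k) (lo k); first by left.
  right; rewrite leNgt; apply/negP => El.
  have cx i : x n k i @[n --> U] --> l i.
    by apply: (near_a (fun n => x n k)) => n; have [_ /(_ k i)[]] := axy n.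
  have lol : lo k < l k by rewrite lt_neqAle eq_sym xlo; case/andP: (lP k).1.
  have near1 : U [set n | lo k < x n k k] by apply: cvgr_gt lol; exact: cx.
  have near2 : U [set n | 0 < E (x n k) k] by apply: cvgr_gt El; exact: contE cx k.
  have [n [/= h1 h2]] := filter_ex (filterI near1 near2).
  have [_ _ /(_ k)[e|e] _] := axy n; first by rewrite e ltxx in h1.
  by rewrite leNgt h2 in e.
- have [<-|xhi] := eqVneq (l k) (hi k); first by left.
  right; rewrite leNgt; apply/negP => El.
  have cy i : y n k i @[n --> U] --> l i.
    by apply: (near_a (fun n => y n k)) => n; have [_ /(_ k i)[]] := axy n.
  have lhi : l k < hi k by rewrite lt_neqAle xhi; case/andP: (lP k).1.
  have near1 : U [set n | y n k k < hi k] by apply: cvgr_lt lhi; exact: cy.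
  have near2 : U [set n | E (y n k) k < 0] by apply: cvgr_lt El; exact: contE cy k.
  have [n [/= h1 h2]] := filter_ex (filterI near1 near2).
  have [_ _ _ /(_ k)[e|e]] := axy n; first by rewrite e ltxx in h1.
  by rewrite leNgt h2 in e.
Qed.
End BoxInequality.

(** * Estimates *)

Section Flux.
Variable R : realType.
Implicit Types a d t : R.
Local Open Scope classical_set_scope.

Definition flux a d : R := `|d| `^ (a - 2) * d.

Lemma flux0 a : flux a 0 = 0. Proof. by rewrite /flux mulr0. Qed.

Lemma flux_ge0 a d : 0 <= d -> 0 <= flux a d.
Proof. by move=> d0; rewrite mulr_ge0 ?powR_ge0. Qed.

Lemma flux_le0 a d : d <= 0 -> flux a d <= 0.
Proof. by move=> d0; rewrite mulr_ge0_le0 ?powR_ge0. Qed.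

Lemma flux_powR a d : 1 < a -> 0 <= d -> flux a d = d `^ (a - 1).
Proof.
move=> a1 d0; rewrite /flux ger0_norm // mulrC -(@mulr_powRB1 _ d (a - 1)) ?subr_gt0 //.
by congr (_ * _ `^ _); ring.
Qed.

Lemma flux_gt0 a d : 0 < d -> 0 < flux a d.
Proof. by move=> d0; rewrite mulr_gt0 ?powR_gt0 ?normr_gt0 ?gt_eqF. Qed.

Lemma flux_homo a d t : 1 < a -> 0 <= d -> d <= t -> flux a d <= flux a t.
Proof.
move=> a1 d0 dt; rewrite !flux_powR ?(le_trans d0 dt) //.
by rewrite ge0_ler_powR ?nnegrE ?(le_trans d0 dt) ?subr_ge0 // ltW.
Qed.

Lemma continuous_flux a : 2 <= a -> continuous (flux a).
Proof.
move=> a2 x.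
have cpow (z : R) : 0 < z -> {for z, continuous (fun t : R => t `^ (a - 2))}.
  move=> z0; apply: differentiable_continuous; apply/derivable1_diffP.
  by apply: derivable_powR; rewrite in_itv /= z0.
(* At 0 the flux is squeezed: its absolute value is at most [|t|] for [|t| <= 1], because [a - 2] is
   nonnegative. *)
have [->|x0] := eqVneq x 0.
  rewrite /continuous_at flux0; apply/norm_cvg0P.
  apply: (@squeeze_cvgr _ _ _ _ (fun=> 0) (fun t : R => `|t|)).
  - near=> t; rewrite normr_ge0 /= /flux normrM (ger0_norm (powR_ge0 _ _)).
    rewrite ler_piMl //.
    have t1 : `|t| <= 1.
      near: t; apply: (@cvgr_norm_le _ _ _ _ _ id 0); first exact: cvg_id.
      by rewrite normr0.
    have [->|t0] := eqVneq t 0.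
      by rewrite normr0; case: (eqVneq (a - 2) 0) => [->|h]; rewrite ?powRr0 ?powR0.
    rewrite -[X in _ <= X](powRr0 `|t|).
    by apply: ger_powR; rewrite ?subr_ge0 // normr_gt0 t0.
  - exact: cvg_cst.
  - have := @cvg_norm _ _ _ _ _ id (0 : R) cvg_id; rewrite normr0; exact.
apply: cvgM; last exact: cvg_id.
apply: (@continuous_cvg _ _ _ _ _ (fun t : R => `|t|) (fun t => t `^ (a - 2))).
  by apply: cpow; rewrite normr_gt0.
exact: (@cvg_norm _ _ _ _ _ id).
Unshelve. all: by end_near. Qed.

Lemma cvg_bigmax (I : finType) (P : pred I) (F : set_system nat) (u : nat -> I -> R)
    (l : I -> R) : Filter F -> (forall i, u n i @[n --> F] --> l i) ->
  \big[Num.max/0]_(i | P i) u n i @[n --> F] --> \big[Num.max/0]_(i | P i) l i.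
Proof.
move=> FF ul; apply: cvg_big => [|i _]; last exact: ul.
by move=> z; apply: (@continuous_max R (R * R)%type fst snd); [exact: cvg_fst|exact: cvg_snd].
Qed.

Lemma finite_upper_bound (I : finType) (h : I -> R) : exists2 K : R, 1 <= K &
  forall i, h i < K.
Proof.
exists (1 + \sum_i `|h i|); first by rewrite lerDl sumr_ge0.
move=> i; rewrite (bigD1 i) //= addrA ltr_wpDr ?sumr_ge0 //.
by apply: le_lt_trans (ler_norm _) _; rewrite ltrDr.
Qed.
End Flux.

Section Extrema.
Variables (R : realType) (T : finType) (A : {set T}) (g : T -> R).

Lemma max_on_ge x : x \in A -> g x <= max_on A g.
Proof.
move=> xA; rewrite /max_on; case: pickP => [x0 _|/(_ x)]; last by rewrite xA.
exact: le_bigmax_cond.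
Qed.

Lemma min_on_le x : x \in A -> min_on A g <= g x.
Proof.
move=> xA; rewrite /min_on; case: pickP => [x0 _|/(_ x)]; last by rewrite xA.
exact: bigmin_le_cond.
Qed.

Lemma max_on_attained : A != finset.set0 -> exists2 x, x \in A & max_on A g = g x.
Proof.
case/set0Pn => x xA; rewrite /max_on; case: pickP => [x0 x0A|/(_ x)]; last by rewrite xA.
elim/big_ind: _ => [|_ _ [y yA ->] [z zA ->]|y yA]; [by exists x0| |by exists y].
by rewrite /Num.max; case: ifP; [exists z|exists y].
Qed.

Lemma min_on_attained : A != finset.set0 -> exists2 x, x \in A & min_on A g = g x.
Proof.
case/set0Pn => x xA; rewrite /min_on; case: pickP => [x0 x0A|/(_ x)]; last by rewrite xA.
elim/big_ind: _ => [|_ _ [y yA ->] [z zA ->]|y yA]; [by exists x0| |by exists y].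
by rewrite /Num.min; case: ifP; [exists y|exists z].
Qed.
End Extrema.

(** * The power inequality behind the constant supersolutions *)

Section Barrier.
Variable R : realType.
Implicit Types a s t : R.

(** Since [ln 2 >= 1/2], the power is at least [exp(s/4)^2 >= (1 + s/4)^2], which exceeds [s] by the
    square [(1 - s/4)^2]. *)
Lemma le_powR2 s : s <= 2 `^ s.
Proof.
have [s0|/ltW s0] := leP s 0; first exact: le_trans s0 (powR_ge0 _ _).
have ln2 : 2^-1 <= ln 2 :> R.
  have h : expR (2^-1) <= 2 :> R.
    have h1 := expR_ge1Dx (- 2^-1 : R).
    rewrite -[leLHS]invrK -expRN -[leRHS]invrK lef_pV2 ?posrE ?expR_gt0 ?invr_gt0 //.
    by apply: le_trans h1; lra.
  by rewrite -[leLHS]expRK ler_ln ?posrE ?expR_gt0.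
have e1 := expR_ge1Dx (s / 4).
have e2 : expR (s / 4) ^+ 2 <= 2 `^ s.
  rewrite -expRM_natl /powR gt_eqF // ler_expR.
  have -> : 2%:R * (s / 4) = s * 2^-1 by field.
  by rewrite ler_wpM2l.
apply: le_trans e2; apply: (@le_trans _ _ ((1 + s / 4) ^+ 2)).
  rewrite -subr_ge0 (_ : _ - s = (1 - s / 4) ^+ 2); last by field.
  exact: sqr_ge0.
by rewrite ler_pXn2r // nnegrE ?expR_ge0 // addr_ge0 // divr_ge0.
Qed.

(** The worst case is [a = 1/2] if [s >= 1] and [a = 1/4] otherwise; there the claim follows from
    [le_powR2] at [s] and at [2 * s]. *)
Lemma mulr_powRB1_le2 a s : 0 < s -> 4^-1 <= a <= 2^-1 -> s * a `^ (s - 1) <= 2.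
Proof.
move=> s0 /andP[a4 a2]; have a0 : 0 < a by lra.
have [s1|s1] := leP 1 s.
  apply: (@le_trans _ _ (2 `^ s * 2^-1 `^ (s - 1))).
    apply: ler_pM; rewrite ?powR_ge0 ?le_powR2 ?(ltW s0) //.
    by rewrite ge0_ler_powR ?nnegrE ?invr_ge0 ?subr_ge0 // ltW.
  rewrite -powR_inv1 // -powRrM -powRD ?pnatr_eq0 ?implybT //.
  by rewrite (_ : s + _ = 1) ?powRr1 //; ring.
apply: (@le_trans _ _ (s * 4^-1 `^ (s - 1))).
  rewrite ler_pM2l // -opprB !powRN lef_pV2 ?posrE ?powR_gt0 ?invr_gt0 //.
  by rewrite ge0_ler_powR ?nnegrE ?invr_ge0 ?subr_ge0 // ltW.
have -> : 4^-1 `^ (s - 1) = 2 `^ (2 * (1 - s)) :> R.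
  have -> : 4^-1 = 2 `^ (- 2%:R) :> R.
    by rewrite powR_invn //; congr (_^-1); ring.
  by rewrite -powRrM; congr (_ `^ _); ring.
have -> : 2 * (1 - s) = 2%:R - (2 * s) :> R by ring.
rewrite powRB ?pnatr_eq0 ?implybT // powR_mulrn //.
rewrite mulrA ler_pdivrMr ?powR_gt0 //.
by have := le_powR2 (2 * s); lra.
Qed.

(** Here [N], [b], [cS] stand for the numbers of all, boundary and interior vertices. As [b <= N]
    and [1 <= cS], the bound on [lambda] gives [lambda * Den < Q * c]; it then suffices to compare
    [c] times the growth bound with [t^(P-1) * Den] term by term, which is [Ha] for [Psi] and [Hb]
    for [Phi]. *)
Lemma barrier_power (P Q m Phi Psi N b cS lambda t : R) :
  2 <= P -> 0 < Q -> 0 < m -> 0 < Phi -> 0 < Psi -> 1 <= N -> 0 <= b <= N -> 1 <= cS ->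
  0 < lambda ->
  lambda < (Q / P * 2 `^ (- (P / 2)) * b `^ (P / 2) * N `^ (1 - P) * N `^ (- (P / 2)))
     / ((Phi / m * N `^ (- (m / 2)) + Psi) * cS) ->
  0 < t -> 4^-1 * N `^ (- (P / 2)) <= t `^ P <= 2^-1 * N `^ (- (P / 2)) ->
  lambda * (Phi * t `^ (m - 1) + Psi) < Q * t `^ (P - 1).
Proof.
move=> P2 Q0 m0 Phi0 Psi0 N1 /andP[b0 bN] cS1 l0 llt t0 /andP[t4 t2].
have P0 : 0 < P by lra.
have N0 : 0 < N by lra.
have Nn : N != 0 by rewrite gt_eqF.
have powN0 x : 0 < N `^ x by rewrite powR_gt0.
pose c := 2 `^ (- (P / 2)) * N `^ (1 - P) / P.
have c0 : 0 < c by rewrite !mulr_gt0 ?powR_gt0 ?invr_gt0.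
pose Den := Phi / m * N `^ (- (m / 2)) + Psi.
have Den0 : 0 < Den by rewrite addr_gt0 // !mulr_gt0 ?invr_gt0.
have lDen : lambda * Den < Q * c.
  have bN1 : b `^ (P / 2) * N `^ (- (P / 2)) <= 1.
    rewrite powRN ler_pdivrMr // mul1r ge0_ler_powR ?nnegrE ?(ltW N0) //.
    by rewrite divr_ge0 // ltW.
  have D0 : 0 < Den * cS by rewrite mulr_gt0 // (lt_le_trans ltr01).
  move: llt; rewrite -/Den ltr_pdivlMr // => llt.
  apply: (@le_lt_trans _ _ (lambda * (Den * cS))).
    by rewrite ler_pM2l // ler_peMr // ltW.
  apply: lt_le_trans llt _.
  have -> : Q / P * 2 `^ (- (P / 2)) * b `^ (P / 2) * N `^ (1 - P) * N `^ (- (P / 2))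
    = Q * c * (b `^ (P / 2) * N `^ (- (P / 2))) by rewrite /c; ring.
  by rewrite ler_piMr // ltW // mulr_gt0.
have two : 2 `^ (- (P / 2)) <= 2^-1 :> R.
  by rewrite -[leRHS]powR_inv1 // ler_powR ?ler1n //; lra.
have t1 : t <= 1.
  rewrite leNgt; apply/negP => t1.
  have : 1 <= t `^ P by rewrite -[leLHS](powRr0 t) ler_powR ?ltW //.
  have : N `^ (- (P / 2)) <= 1 by rewrite -[leRHS](powRr0 N) ler_powR //; lra.
  by move: t2 => /[swap] ? /[swap] ?; lra.
have tP : t `^ P = t * t `^ (P - 1) by rewrite mulr_powRB1 // ltW.
set X := t `^ (P - 1) in tP *.
have X0 : 0 < X by rewrite powR_gt0.
have Ha : c <= X.
  apply: (@le_trans _ _ (t `^ P)); last by rewrite tP ler_piMl // ltW.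
  apply: le_trans t4; rewrite /c.
  have N2 : N `^ (1 - P) <= N `^ (- (P / 2)) by rewrite ler_powR //; lra.
  have iP : P^-1 <= 2^-1 by rewrite lef_pV2 ?posrE.
  have -> : 4^-1 * N `^ (- (P / 2)) = 2^-1 * N `^ (- (P / 2)) * 2^-1 by field.
  by rewrite ?ler_pM ?mulr_ge0 ?powR_ge0 ?invr_ge0 // ltW.
(* With [t^P = a * N^(-P/2)] and [s = m / P], the ratio of the two sides is
   [s * a^(s-1) * 2^(-P/2) * N^(1-P/2)], at most [2 * 2^-1 * 1]. *)
have Hb : c * t `^ (m - 1) <= X * (m^-1 * N `^ (- (m / 2))).
  pose s := m / P; pose a := t `^ P * N `^ (P / 2).
  have s0 : 0 < s by rewrite divr_gt0.
  have aB : 4^-1 <= a <= 2^-1.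
    by move: t4 t2; rewrite powRN ler_pdivlMr // ler_pdivrMr // => -> ->.
  have tm : t `^ (m - 1) = X * (a `^ (s - 1) * N `^ (- (m / 2) + P / 2)).
    have tN : t `^ P = a * N `^ (- (P / 2)) by rewrite powRN /a mulfK ?gt_eqF.
    have -> : - (m / 2) + P / 2 = - (P / 2) * (s - 1) by rewrite /s; field; lra.
    rewrite powRrM -powRM ?powR_ge0 //; last by lra.
    rewrite -tN -powRrM /X -powRD; last by rewrite (gt_eqF t0) implybT.
    by congr (_ `^ _); rewrite /s; field; lra.
  have key := mulr_powRB1_le2 s0 aB.
  rewrite tm mulrCA ler_pM2l //.
  have -> : c * (a `^ (s - 1) * N `^ (- (m / 2) + P / 2)) =
     m^-1 * N `^ (- (m / 2)) *
      ((s * a `^ (s - 1)) * 2 `^ (- (P / 2)) * N `^ (1 - P / 2)).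
    have -> : 1 - P / 2 = (1 - P) + P / 2 by field.
    rewrite /c (@powRD _ _ (- (m / 2))) ?Nn ?implybT // (@powRD _ _ (1 - P)) ?Nn ?implybT //.
    by rewrite /s; field; lra.
  rewrite ler_piMr ?mulr_ge0 ?powR_ge0 ?invr_ge0 ?(ltW m0) //.
  have NP : N `^ (1 - P / 2) <= 1 by rewrite -[leRHS](powRr0 N) ler_powR //; lra.
  have h2 : s * a `^ (s - 1) * 2 `^ (- (P / 2)) <= 1.
    apply: (@le_trans _ _ (2 * 2^-1)); last by rewrite divff.
    by apply: ler_pM => //; apply: mulr_ge0; rewrite ?powR_ge0 // ltW.
  apply: mulr_ile1 => //; rewrite ?powR_ge0 //.
  by do 2?apply: mulr_ge0; rewrite ?powR_ge0 // ltW.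
rewrite -(ltr_pM2l c0).
have h : c * (Phi * t `^ (m - 1) + Psi) <= X * Den.
  rewrite /Den !mulrDr lerD //; last by rewrite ler_pM2r.
  rewrite mulrCA [leRHS](_ : _ = Phi * (X * (m^-1 * N `^ (- (m / 2))))); last by ring.
  by rewrite ler_pM2l.
apply: (@le_lt_trans _ _ (X * (lambda * Den))); last first.
  by rewrite [ltRHS](_ : _ = X * (Q * c)) ?ltr_pM2l //; ring.
by rewrite mulrCA [leRHS]mulrCA ler_pM2l.
Qed.
End Barrier.

(** * The two solutions *)

Section Residual.
Variables (R : realType) (T : finType) (S : {set T}).
Variables (w : T -> T -> R) (p q : T -> R) (f : T -> R -> R) (lambda : R).
Hypothesis w_ge0 : forall x y, 0 <= w x y.
Hypothesis p_ge2 : forall x, 2 <= p x.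
Hypothesis q_gt0 : forall x, x \in S -> 0 < q x.
Hypothesis f_cont : forall x, x \in S -> continuous (f x).
Hypothesis lambda_gt0 : 0 < lambda.
Implicit Types u : T -> R.

Definition residual u x :=
  - plaplacian w p u x + q x * `|u x| `^ (p x - 2) * u x - lambda * f x (u x).

Lemma residualE u x : residual u x =
  - (\sum_y flux (p x) (u y - u x) * w x y) + q x * flux (p x) (u x) - lambda * f x (u x).
Proof. by rewrite /residual mulrA. Qed.

Lemma residual_solution u : (forall x, x \in S -> residual u x = 0) ->
  (forall x, x \in ~: S -> u x = 0) -> (forall x, x \in S -> 0 < u x) ->
  positive_solution S w p q f lambda u.
Proof. by move=> G0 u0 up; split=> // x xS; apply/eqP; rewrite -subr_eq0 -(G0 x xS). Qed.

Lemma residual_argmin u x : (forall y, u x <= u y) ->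
  residual u x <= q x * flux (p x) (u x) - lambda * f x (u x).
Proof.
move=> ux; rewrite residualE lerD2r gerDr oppr_le0.
by apply: sumr_ge0 => y _; rewrite mulr_ge0 ?w_ge0 ?flux_ge0 ?subr_ge0.
Qed.

Lemma residual_argmax u x : (forall y, u y <= u x) ->
  q x * flux (p x) (u x) - lambda * f x (u x) <= residual u x.
Proof.
move=> ux; rewrite residualE lerD2r lerDr oppr_ge0.
by apply: sumr_le0 => y _; rewrite mulr_le0_ge0 ?w_ge0 ?flux_le0 ?subr_le0.
Qed.

(** Since [u y >= 0], the flux of [u x - u y] is at most that of [u x]: the bound involves no other
    value of [u]. *)
Lemma residual_le u x : (forall y, 0 <= u y) ->
  residual u x <= (\sum_y w x y + q x) * flux (p x) (u x) - lambda * f x (u x).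
Proof.
move=> u0; have p1 : 1 < p x by apply: lt_le_trans (p_ge2 x); rewrite ltr1n.
have fluxN a d : flux a (- d) = - flux a d :> R by rewrite /flux normrN mulrN.
rewrite residualE lerD2r mulrDl lerD2r -sumrN mulr_suml; apply: ler_sum => y _.
rewrite -mulNr -fluxN opprB mulrC ler_wpM2l ?w_ge0 //.
have [xy|yx] := leP (u x) (u y).
  by rewrite (le_trans (flux_le0 _ _)) ?flux_ge0 // subr_le0.
by rewrite flux_homo ?subr_ge0 ?(ltW yx) // lerBlDr lerDl.
Qed.

Lemma residual_cvg (F : set_system nat) (u : nat -> T -> R) (l : T -> R) :
  ProperFilter F -> (forall y, (u n y @[n --> F] --> l y)%classic) ->
  forall x, x \in S -> (residual (u n) x @[n --> F] --> residual l x)%classic.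
Proof.
move=> FF ul x xS.
have cflux (v : nat -> R) (a : R) : (v n @[n --> F] --> a)%classic ->
    (flux (p x) (v n) @[n --> F] --> flux (p x) a)%classic.
  by move=> va; apply: continuous_cvg va; apply: continuous_flux.
rewrite residualE; under eq_fun do rewrite residualE.
apply: cvgB; last first.
  apply: cvgMl_tmp; apply: (@continuous_cvg _ _ _ _ _ (fun n => u n x) (f x)); last exact: ul.
  exact: f_cont.
apply: cvgD; last by apply: cvgMl_tmp; apply: cflux.
apply: cvgN; apply: cvg_big => [z|y _].
  by apply: (@cvgD _ _ _ (nbhs z)); [exact: cvg_fst|exact: cvg_snd].
by apply: cvgMr_tmp; apply: cflux; apply: cvgB; exact: ul.
Qed.

Hypothesis f0_gt0 : forall x (t : R), x \in S -> 0 <= t -> 0 < f x t.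

Lemma residual_lt0 u x : x \in S -> (forall y, 0 <= u y) -> u x = 0 -> residual u x < 0.
Proof.
move=> xS u0 ux; apply: (@le_lt_trans _ _ (q x * flux (p x) (u x) - lambda * f x (u x))).
  by apply: residual_argmin => y; rewrite ux.
by rewrite ux flux0 mulr0 sub0r oppr_lt0 mulr_gt0 ?f0_gt0.
Qed.

Variables (c : R).
Hypothesis c_gt0 : 0 < c.
Hypothesis barrier_c : forall x, x \in S -> lambda * f x c < q x * flux (p x) c.

(** On [S] the residual is negative where [u x = 0] and positive where [u x = c], a maximum, so no
    bound of the box is attained. Off [S] the field is [u x] itself, which forces the boundary value
    0. *)
Lemma small_solution : exists2 u, positive_solution S w p q f lambda u &
  forall x, x \in S -> u x < c.
Proof.
pose E u x := if x \in S then residual u x else u x.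
have [|F FF u l ul x|u [ub ulo uhi]] := @box_variational_inequality R T E (fun=> 0) (fun=> c).
- by [].
- by rewrite /E; case: ifP => [xS|_]; [apply: residual_cvg|apply: ul].
have u0 y : 0 <= u y by case/andP: (ub y).
have up x : x \in S -> 0 < u x.
  move=> xS; rewrite lt_neqAle u0 andbT; apply/eqP => /esym ux.
  have := uhi x; rewrite /E xS ux => -[e|]; first by move: c_gt0; rewrite -e ltxx.
  by rewrite leNgt residual_lt0.
have uc x : x \in S -> u x < c.
  move=> xS; rewrite lt_neqAle; case/andP: (ub x) => _ ->; rewrite andbT.
  apply/eqP => ux; have := ulo x; rewrite /E xS ux => -[e|].
    by move: c_gt0; rewrite e ltxx.
  rewrite leNgt => /negP[]; apply: (@lt_le_trans _ _ (q x * flux (p x) (u x) - lambda * f x (u x))).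
    by rewrite ux subr_gt0 barrier_c.
  by apply: residual_argmax => y; rewrite ux; case/andP: (ub y).
exists u => //; apply: residual_solution => // x xS.
  have := ulo x; have := uhi x; rewrite /E xS => -[e|h1]; first by have := uc x xS; rewrite e ltxx.
  case=> [e|h2]; first by have := up x xS; rewrite e ltxx.
  by apply/eqP; rewrite eq_le h1 h2.
have := ulo x; rewrite /E; move: xS; rewrite inE => /negbTE -> [//|h].
by apply/eqP; rewrite eq_le h u0.
Qed.

Variables (c' M K : R).
Hypothesis S_neq0 : S != finset.set0.
Hypothesis cc' : c < c' <= M.
Hypothesis barrier : forall x t, x \in S -> c <= t <= c' ->
  lambda * f x t < q x * flux (p x) t.
Hypothesis superlinear : forall x t, x \in S -> M <= t ->
  (\sum_y w x y + q x) * flux (p x) t < lambda * f x t.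
Hypothesis K_ge : forall x, x \in S -> \sum_y w x y + q x <= K.
Hypothesis K_f : forall x t, x \in S -> c <= t <= M + 2 ->
  lambda * f x t < K * Num.min 1 (c' - c) * flux (p x) t.

(* The level [r] of the maximum is an extra unknown; the excess of the maximum
   over [r] multiplies a large penalty, and must vanish at a solution. *)
Lemma large_solution : exists2 u, positive_solution S w p q f lambda u &
  exists2 x, x \in S & c <= u x.
Proof.
pose top u : R := \big[Num.max/0]_(x in S) u x.
pose E (z : option T -> R) i := let u x := z (Some x) in let tau := top u - z None in
  if i is Some x then
    if x \in S then residual u x + K * tau * flux (p x) (u x) else u x
  else tau.
pose lo (i : option T) : R := if i is Some _ then 0 else c.
(* The offsets make [u x = M + 2] imply [tau >= 1], and [r = M + 1] with [top u < M] imply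
   [tau < -1]. *)
pose hi (i : option T) : R := if i is Some _ then M + 2 else M + 1.
have [cc1 cM] := andP cc'; have c0 := c_gt0.
have d0 : 0 < c' - c by rewrite subr_gt0.
have K0 : 0 < K.
  have /set0Pn[x xS] := S_neq0; apply: lt_le_trans (K_ge xS).
  by rewrite ltr_wpDl ?q_gt0 // sumr_ge0.
have [||z [zb zlo zhi]] := @box_variational_inequality R (option T) E lo hi.
- by case=> [x|]; rewrite /lo /hi; lra.
- move=> F FF u l ul i.
  have ctop : ((top (fun x => u n (Some x)) - u n None) @[n --> F] -->
      top (fun x => l (Some x)) - l None)%classic.
    by apply: cvgB; [apply: cvg_bigmax => x; apply: ul|apply: ul].
  case: i => [x|] //=; case: ifP => [xS|_]; last exact: ul.
  apply: cvgD; first exact: (residual_cvg FF (fun y => ul (Some y)) xS).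
  apply: cvgM; first exact: cvgMl_tmp.
  by apply: continuous_cvg (ul _); apply: continuous_flux.
pose u x := z (Some x); pose r := z None; pose tau := top u - r.
have u0 y : 0 <= u y by case/andP: (zb (Some y)).
have uM y : u y <= M + 2 by case/andP: (zb (Some y)).
have /andP[rc rM] : c <= r <= M + 1 by exact: zb None.
have uS x : x \notin S -> u x = 0.
  move=> xS; have := zlo (Some x); rewrite /E /= (negbTE xS) => -[//|h].
  by apply/eqP; rewrite eq_le h u0.
have elo x : x \in S -> u x = 0 \/ residual u x + K * tau * flux (p x) (u x) <= 0.
  by move=> xS; have := zlo (Some x); rewrite /E /= xS.
have ehi x : x \in S -> u x = M + 2 \/ 0 <= residual u x + K * tau * flux (p x) (u x).
  by move=> xS; have := zhi (Some x); rewrite /E /= xS.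
have top_ge x : x \in S -> u x <= top u by move=> xS; exact: le_bigmax_cond.
have up x : x \in S -> 0 < u x.
  move=> xS; rewrite lt_neqAle u0 andbT; apply/eqP => /esym ux.
  have := ehi x xS; rewrite ux flux0 mulr0 addr0 => -[|]; first by lra.
  by rewrite leNgt residual_lt0.
have min1 : Num.min 1 (c' - c) <= 1 by rewrite ge_min lexx.
have mind : Num.min 1 (c' - c) <= c' - c by rewrite ge_min lexx orbT.
(* The bound [u x = M + 2] is excluded: [x] would be a maximum with [tau >= 1], and the penalty
   would exceed [lambda * f]. *)
have Gtau x : x \in S -> residual u x = - (K * tau * flux (p x) (u x)).
  move=> xS; apply/eqP; rewrite -addr_eq0.
  have [e|h1] := elo x xS; first by have := up x xS; rewrite e ltxx.
  have [e|h2] := ehi x xS; last by rewrite eq_le h1.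
  have tau1 : 1 <= tau by have := top_ge x xS; rewrite e /tau; lra.
  have h3 : - (lambda * f x (u x)) <= residual u x.
    apply: le_trans (residual_argmax _) => [|y]; last by rewrite e.
    by rewrite lerDr mulr_ge0 ?flux_ge0 // ltW ?q_gt0.
  have h4 : lambda * f x (u x) < K * Num.min 1 (c' - c) * flux (p x) (u x).
    by apply: K_f => //; rewrite e; lra.
  have h5 : K * Num.min 1 (c' - c) * flux (p x) (u x) <= K * tau * flux (p x) (u x).
    by rewrite ler_wpM2r ?flux_ge0 // ler_pM2l // (le_trans min1).
  by exfalso; move: h1 h3 h4 h5; lra.
have [x xS topx] : exists2 x, x \in S & top u = u x.
  have /set0Pn[x0 x0S] := S_neq0.
  have [x [xS ux]] : exists x, x \in S /\ forall y, y \in S -> u y <= u x.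
    by case: (@arg_maxP _ _ _ x0 (mem S) u x0S) => x xS h; exists x.
  exists x => //; apply/le_anti; rewrite top_ge // andbT.
  by apply/bigmax_leP; split.
have umax y : u y <= u x.
  have [yS|/uS ->] := boolP (y \in S); last exact: u0.
  by rewrite -topx top_ge.
have ux0 := up x xS.
have fx0 : 0 < flux (p x) (u x) by exact: flux_gt0.
have Gx := Gtau x xS; have Gmax := residual_argmax umax.
have qx := q_gt0 xS.
(* If [tau < 0] then [r = M + 1] and the residual at the maximum [x] is positive, against
   superlinearity if [u x >= M] and against [K_ge] otherwise. If [tau > 0] then [r = c] and the
   residual is negative, against the barrier if [u x <= c'] and against [K_f] otherwise. *)
have tau0 : tau = 0.
  have rlo : r = c \/ tau <= 0 := zlo None.
  have rhi : r = M + 1 \/ 0 <= tau := zhi None.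
  have [tneg|tpos|//] := ltgtP tau 0.
    have rM1 : r = M + 1 by case: rhi => // h; move: tneg; rewrite ltNge h.
    have Gpos : 0 < residual u x.
      by rewrite Gx oppr_gt0 pmulr_llt0 // pmulr_rlt0.
    have [ltM|geM] := ltP (u x) M.
      have h1 := residual_le x u0.
      have h2 : 0 < lambda * f x (u x) by rewrite mulr_gt0 ?f0_gt0.
      have h3 : (\sum_y w x y + q x) * flux (p x) (u x) <= K * flux (p x) (u x).
        by rewrite ler_pM2r // K_ge.
      have h4 : K * flux (p x) (u x) <= - (K * tau * flux (p x) (u x)).
        rewrite -mulNr -mulrN ler_pM2r // ler_peMr ?(ltW K0) //.
        by rewrite /tau topx rM1; lra.
      by exfalso; move: h1 h2 h3 h4; rewrite Gx; lra.
    have h1 := residual_le x u0; have h2 := superlinear xS geM.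
    by exfalso; move: h1 h2 Gpos; lra.
  have rc1 : r = c by case: rlo => // h; move: tpos; rewrite ltNge h.
  have [le1|gt1] := leP (u x) c'.
    have h1 : lambda * f x (u x) < q x * flux (p x) (u x).
      by apply: barrier => //; rewrite le1 andbT; move: tpos; rewrite /tau topx rc1; lra.
    have h2 : 0 < K * tau * flux (p x) (u x) by apply: mulr_gt0 fx0; apply: mulr_gt0.
    by exfalso; move: h1 h2 Gmax; rewrite Gx; lra.
  have h1 : lambda * f x (u x) < K * Num.min 1 (c' - c) * flux (p x) (u x).
    by apply: K_f => //; rewrite uM andbT; lra.
  have h2 : K * Num.min 1 (c' - c) * flux (p x) (u x) <= K * tau * flux (p x) (u x).
    rewrite ler_wpM2r ?flux_ge0 // ler_pM2l // (le_trans mind) //.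
    by rewrite /tau topx rc1; lra.
  have h3 : 0 < q x * flux (p x) (u x) by rewrite mulr_gt0.
  by exfalso; move: h1 h2 h3 Gmax; rewrite Gx; lra.
exists u; last by exists x => //; rewrite -topx; move: tau0; rewrite /tau; lra.
apply: residual_solution => // y; last by rewrite inE; exact: uS.
by move=> yS; rewrite Gtau // tau0 mulr0 mul0r oppr0.
Qed.
End Residual.

(** * Choice of the constants and conclusion *)

Theorem theorem13 (R : realType) (T : finType) (S : {set T}) (e : rel T)
    (w : T -> T -> R) (p q : T -> R) (f : T -> R -> R)
    (S_neq0 : S != finset.set0) (bS_neq0 : ~: S != finset.set0)
    (e_simple : simple_graph e) (e_conn : connected_graph e)
    (w_weight : graph_weight e w)
    (q_gt0 : forall x, x \in S -> 0 < q x)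
    (p_ge2 : forall x, 2 <= p x)
    (f_cont : forall x, x \in S -> continuous (f x))
    (m1 m2 phi1 phi2 psi1 psi2 : T -> R)
    (m1_ge2 : forall x, x \in S -> 2 <= m1 x)
    (m2_ge2 : forall x, x \in S -> 2 <= m2 x)
    (phi1_gt0 : forall x, x \in S -> 0 < phi1 x)
    (phi2_gt0 : forall x, x \in S -> 0 < phi2 x)
    (psi1_gt0 : forall x, x \in S -> 0 < psi1 x)
    (psi2_gt0 : forall x, x \in S -> 0 < psi2 x)
    (f_growth : forall x t, x \in S -> 0 <= t ->
       psi1 x + phi1 x * t `^ (m1 x - 1) <= f x t
         <= phi2 x * t `^ (m2 x - 1) + psi2 x)
    (m1_gt_p : max_on [set: T] p < min_on S m1)
    (lambda : R) (lambda_gt0 : 0 < lambda)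
    (lambda_lt : lambda < lambda2 S p q m2 phi2 psi2) :
  exists u v : T -> R,
    [/\ u <> v,
        positive_solution S w p q f lambda u &
        positive_solution S w p q f lambda v].
Proof.
have w_ge0 x y : 0 <= w x y by case: w_weight.
have /set0Pn[x0 x0S] := S_neq0.
pose P := max_on S p; pose Q := min_on S q; pose m := min_on S m2.
pose Phi := max_on S phi2; pose Psi := max_on S psi2; pose N : R := #|T|%:R.
have P2 : 2 <= P by apply: le_trans (p_ge2 x0) (max_on_ge _ x0S).
have P0 : 0 < P by apply: lt_le_trans P2.
have Q0 : 0 < Q by rewrite /Q; have [x xS ->] := min_on_attained q S_neq0; exact: q_gt0.
have m20 : 2 <= m by rewrite /m; have [x xS ->] := min_on_attained m2 S_neq0; exact: m2_ge2.
have Phi0 : 0 < Phi by rewrite /Phi; have [x xS ->] := max_on_attained phi2 S_neq0; exact: phi2_gt0.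
have Psi0 : 0 < Psi by rewrite /Psi; have [x xS ->] := max_on_attained psi2 S_neq0; exact: psi2_gt0.
have N1 : 1 <= N by rewrite ler1n; apply/card_gt0P; exists x0.
have N0 : 0 < N by exact: lt_le_trans N1.
have powN0 x : 0 < N `^ x by rewrite powR_gt0.
have f_gt0 x t : x \in S -> 0 <= t -> 0 < f x t.
  move=> xS t0; case/andP: (f_growth x t xS t0) => h _; apply: lt_le_trans h.
  by rewrite ltr_pwDl ?psi1_gt0 // mulr_ge0 ?powR_ge0 // ltW ?phi1_gt0.
have f_le x t : x \in S -> 0 <= t -> f x t <= phi2 x * t `^ (m2 x - 1) + psi2 x.
  by move=> xS t0; case/andP: (f_growth x t xS t0).
(* [rad a] solves [t^P = a * N^(-P/2)]; the values 1/4 and 1/2 of [a] give the range of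
   [barrier_power]. *)
pose rad (a : R) := a `^ P^-1 * N `^ (- 2^-1).
have rad_gt0 a : 0 < a -> 0 < rad a by move=> a0; rewrite mulr_gt0 ?powR_gt0.
have radP a : 0 < a -> rad a `^ P = a * N `^ (- (P / 2)).
  move=> a0; rewrite powRM ?powR_ge0 // -!powRrM mulVf ?gt_eqF // powRr1 ?(ltW a0) //.
  by congr (_ * _ `^ _); ring.
pose c := rad 4^-1; pose c' := rad 2^-1.
have c0 : 0 < c by apply: rad_gt0; rewrite invr_gt0.
have cc' : c < c'.
  rewrite ltr_pM2r // gt0_ltr_powR ?invr_gt0 ?nnegrE ?invr_ge0 //.
  by rewrite ltf_pV2 ?posrE // ltr_nat.
have c'1 : c' <= 1.
  rewrite mulr_ile1 ?powR_ge0 //.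
    rewrite -[leRHS](powRr0 2^-1) ger_powR ?invr_ge0 ?(ltW P0) //.
    by rewrite invr_gt0 ltr0n /= invf_le1 // ler1n.
  by rewrite -[leRHS](powRr0 N) ler_powR // oppr_le0 invr_ge0.
have p1 x : 1 < p x by apply: lt_le_trans (p_ge2 x); rewrite ltr1n.
have barrier x t : x \in S -> c <= t <= c' -> lambda * f x t < q x * flux (p x) t.
  move=> xS /andP[ct tc']; have t0 : 0 < t by exact: lt_le_trans ct.
  have t1 : t <= 1 by exact: le_trans tc' c'1.
  have t01 : 0 < t <= 1 by rewrite t0.
  (* Because [t <= 1], replacing [m2 x] by its minimum and [p x] by its maximum goes in the right
     direction. *)
  have key : lambda * (Phi * t `^ (m - 1) + Psi) < Q * t `^ (P - 1).
    apply: (@barrier_power _ _ _ _ _ _ N #|~: S|%:R #|S|%:R) => //.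
    - exact: lt_le_trans m20.
    - by rewrite ler0n ler_nat max_card.
    - by rewrite ler1n; apply/card_gt0P; exists x0.
    - rewrite -(radP 4^-1) ?invr_gt0 // -(radP 2^-1) ?invr_gt0 //.
      by rewrite !ge0_ler_powR ?nnegrE ?(ltW P0) ?(ltW t0) ?(ltW c0) // ltW // (lt_trans c0).
  apply: (@le_lt_trans _ _ (lambda * (Phi * t `^ (m - 1) + Psi))).
    rewrite ler_pM2l //; apply: le_trans (f_le x t xS (ltW t0)) _.
    rewrite lerD ?max_on_ge // ler_pM ?powR_ge0 ?max_on_ge ?(ltW (phi2_gt0 x xS)) //.
    by apply: ger_powR => //; rewrite lerD2r min_on_le.
  apply: lt_le_trans key _; rewrite flux_powR ?(ltW t0) //.
  rewrite ler_pM ?powR_ge0 ?(ltW Q0) ?min_on_le //.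
  by apply: ger_powR => //; rewrite lerD2r max_on_ge.
pose W x := \sum_y w x y + q x.
have W0 x : x \in S -> 0 < W x by move=> xS; rewrite ltr_wpDl ?q_gt0 // sumr_ge0.
pose delta := min_on S m1 - max_on [set: T] p.
have delta0 : 0 < delta by rewrite subr_gt0.
have [K1 K11 K1P] := finite_upper_bound (fun x => W x / (lambda * phi1 x)).
(* For [t >= M] this gives [t^(m1 x - p x) >= t^delta >= K1], which exceeds
   [W x / (lambda * phi1 x)]. *)
pose M := K1 `^ delta^-1.
have M1 : 1 <= M by rewrite -[leLHS](powRr0 K1) ler_powR // invr_ge0 ltW.
have M0 : 0 < M by exact: lt_le_trans M1.
have superlin x t : x \in S -> M <= t -> W x * flux (p x) t < lambda * f x t.
  move=> xS Mt; have t1 : 1 <= t by exact: le_trans M1 Mt.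
  have t0 : 0 < t by exact: lt_le_trans t1.
  case/andP: (f_growth x t xS (ltW t0)) => h _.
  have lphi : 0 < lambda * phi1 x by rewrite mulr_gt0 ?phi1_gt0.
  have tK : K1 <= t `^ (m1 x - p x).
    apply: (@le_trans _ _ (t `^ delta)); last first.
      by rewrite ler_powR // lerB ?min_on_le ?max_on_ge ?inE.
    rewrite -[leLHS]powRr1 ?(le_trans ler01) // -(mulVf (lt0r_neq0 delta0)) powRrM.
    by rewrite ge0_ler_powR ?nnegrE ?powR_ge0 ?(ltW t0) // ltW.
  have tp : 0 < t `^ (p x - 1) by rewrite powR_gt0.
  rewrite flux_powR ?(ltW t0) //.
  apply: (@lt_le_trans _ _ (lambda * (phi1 x * t `^ (m1 x - 1)))); last first.
    by rewrite ler_pM2l // (le_trans _ h) // lerDr ltW ?psi1_gt0.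
  have -> : m1 x - 1 = (m1 x - p x) + (p x - 1) by ring.
  rewrite (@powRD _ _ (m1 x - p x)); last by rewrite (gt_eqF t0) implybT.
  rewrite !mulrA ltr_pM2r // mulrC -ltr_pdivrMr //.
  exact: lt_le_trans (K1P x) tK.
pose d := Num.min 1 (c' - c).
have d0 : 0 < d by rewrite lt_min ltr01 subr_gt0.
(* The numerator bounds [lambda * f x t] for [c <= t <= M + 2], and the flux is at least its value
   at [c]; any [K] above [B x] thus satisfies [K_f]. *)
pose B x := lambda * (phi2 x * (M + 2) `^ (m2 x - 1) + psi2 x) / (d * flux (p x) c).
have [K K_1 KP] := finite_upper_bound (fun x => Num.max (W x) (B x)).
have [u su uc] : exists2 u, positive_solution S w p q f lambda u &
    forall x, x \in S -> u x < c.
  apply: small_solution => // x xS.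
  by apply: barrier => //; rewrite lexx ltW.
have [v sv [x xS vc]] : exists2 v, positive_solution S w p q f lambda v &
    exists2 x, x \in S & c <= v x.
  apply: (@large_solution _ _ _ _ _ _ _ _ w_ge0 p_ge2 q_gt0 f_cont lambda_gt0 f_gt0
    c c0 c' M K) => //.
  - by rewrite cc' (le_trans c'1).
  - by move=> x xS; rewrite ltW // (le_lt_trans _ (KP x)) // le_max lexx.
  - move=> x t xS /andP[ct tM]; have t0 : 0 < t by exact: lt_le_trans ct.
    have Bx : B x < K by rewrite (le_lt_trans _ (KP x)) // le_max lexx orbT.
    have fc0 : 0 < flux (p x) c by rewrite flux_gt0.
    apply: (@le_lt_trans _ _ (lambda * (phi2 x * (M + 2) `^ (m2 x - 1) + psi2 x))).
      rewrite ler_pM2l //; apply: le_trans (f_le x t xS (ltW t0)) _.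
      rewrite lerD2r ler_pM2l ?phi2_gt0 // ge0_ler_powR ?nnegrE ?(ltW t0) //.
        by rewrite subr_ge0 (le_trans _ (m2_ge2 x xS)) // ler1n.
      by rewrite (le_trans (ltW t0)).
    apply: (@lt_le_trans _ _ (K * d * flux (p x) c)).
      by rewrite -mulrA -ltr_pdivrMr // mulr_gt0.
    rewrite ler_pM2l ?flux_homo ?(ltW c0) // mulr_gt0 //.
    exact: lt_le_trans K_1.
exists u, v; split=> // uv; have := uc x xS.
by rewrite uv ltNge vc.
Qed.
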